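(* Let $n\ge 2$, $\delta,\sigma\in\mathbb{R}$, $T=(n;\delta,\sigma)$, $h\in\{1,\dots,n\}$, and $c=\cos\frac{h\pi}{n+1}$. The unique symmetric tridiagonal Toeplitz matrix with null $h$th eigenvalue closest to $T$ in the Frobenius norm is $S_*^{\mathcal{T}}=(n;\delta_*,\sigma_* )$, where $$\delta_*=\frac{2\left(nc^2\delta-(n-1)c\sigma\right)}{n-1+2nc^2},\qquad \sigma_*=\frac{(n-1)\sigma-nc\delta}{n-1+2nc^2}.$$ Moreover, $$\|T-S_*^{\mathcal{T}}\|_F=\frac{|\delta+2c\sigma|}{\sqrt{\frac1n+\frac{2c^2}{n-1}}}.$$
   Context: $(n;d,s)$ denotes the $n\times n$ real symmetric tridiagonal Toeplitz matrix with all diagonal entries equal to $d$ and all sub- and superdiagonal entries equal to $s$ ($d,s\in\mathbb{R}$). The $h$th eigenvalue of $(n;d,s)$ is, by definition of the numbering, $d+2s\cos\frac{h\pi}{n+1}$, $h=1,\dots,n$. $\|\cdot\|_F$ is the Frobenius norm. *)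

(* Defs.v *)
From mathcomp Require Import all_boot all_order all_algebra.
From mathcomp Require Import reals trigo.
From mathcomp Require Import ring lra.

Set Implicit Arguments.
Unset Strict Implicit.
Unset Printing Implicit Defensive.

Import Order.TTheory GRing.Theory Num.Theory.
Local Open Scope ring_scope.

Section Definitions.
Variable R : realType.

Definition frobenius_norm (m n : nat) (A : 'M[R]_(m, n)) : R :=
  Num.sqrt (\sum_i \sum_j A i j ^+ 2).

(* The matrix written (n; d, s). *)
Definition symtridiag_toeplitz (n : nat) (d s : R) : 'M[R]_n :=
  \matrix_(i < n, j < n)
    if i == j then d
    else if (i.+1 == j :> nat) || (j.+1 == i :> nat) then s
    else 0.

(* The h-th eigenvalue of (n; d, s), numbered by h = 1, ..., n (not necessarily
   in increasing or decreasing order: that depends on the sign of s);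
   [char_poly_symtridiag_toeplitz] shows that these are the eigenvalues,
   counted with multiplicity. *)
Definition toeplitz_eigenvalue (n : nat) (d s : R) (h : nat) : R :=
  d + 2 * s * cos (h%:R * pi / n.+1%:R).

(* For n >= 2 the pair (d, s) is determined by A; for n = 1 the parameter s does
   not occur in the matrix. *)
Definition symtridiag_toeplitz_null (n h : nat) (A : 'M[R]_n) : Prop :=
  exists d s : R,
    A = symtridiag_toeplitz n d s /\ toeplitz_eigenvalue n d s h = 0.

Definition frobenius_closest (m n : nat) (P : 'M[R]_(m, n) -> Prop)
    (T S : 'M[R]_(m, n)) : Prop :=
  P S /\ forall A, P A -> frobenius_norm (T - S) <= frobenius_norm (T - A).

End Definitions.

Section Spectrum.
Variable R : realType.
Implicit Types (n h : nat) (d s : R).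

Let angle n h : R := h%:R * pi / n.+1%:R.

Lemma symtridiag_toeplitz_mulrow n d s (f : nat -> R) (j : 'I_n) :
  f 0 = 0 -> f n.+1 = 0 ->
  \sum_(i < n) f i.+1 * symtridiag_toeplitz n d s i j =
  d * f j.+1 + s * (f j + f j.+2).
Proof.
move=> f0 fn.
have pick k : (\sum_(i < n | i == k :> nat) f i.+1) =
              if (k < n)%N then f k.+1 else 0.
  case: ltnP => kn; last first.
    by rewrite big1// => i /eqP ik; have := ltn_ord i; rewrite ik ltnNge kn.
  by rewrite (big_pred1 (Ordinal kn)).
transitivity (\sum_(i < n) (d * (if i == j :> nat then f i.+1 else 0) +
   s * ((if i.+1 == j :> nat then f i.+1 else 0) +
        (if i == j.+1 :> nat then f i.+1 else 0)))).
  apply: eq_bigr => i _; rewrite mxE -val_eqE (eq_sym j.+1).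
  case: (ltngtP (i : nat) j) => ij /=.
  - rewrite (ltn_eqF (leqW ij)) orbF.
    by case: (i.+1 == j); ring.
  - rewrite (gtn_eqF (leqW ij)) /=.
    by case: (i == j.+1 :> nat); ring.
  - by rewrite ij gtn_eqF// ltn_eqF//; ring.
rewrite big_split/= -!mulr_sumr big_split/= -!big_mkcond/= !pick ltn_ord.
congr (_ + _ * (_ + _)).
  case: (posnP j) => [j0|j0].
    by rewrite j0 f0 big1.
  rewrite (eq_bigl (fun i : 'I_n => i == j.-1 :> nat)); last first.
    by move=> i /=; rewrite -(prednK j0) eqSS.
  by rewrite pick prednK// (leq_trans _ (ltn_ord j)) ?leqW// prednK.
by case: ltnP => // nj; rewrite (_ : j.+1 = n) ?fn//; apply/eqP; rewrite eqn_leq ltn_ord.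
Qed.

Lemma angle_in n h : (1 <= h <= n)%N -> 0 < angle n h < pi.
Proof.
move=> /andP[h1 hn]; rewrite /angle; apply/andP; split.
  by rewrite divr_gt0 ?mulr_gt0 ?pi_gt0 ?ltr0n.
by rewrite ltr_pdivrMr ?ltr0n// mulrC ltr_pM2l ?pi_gt0// ltr_nat ltnS.
Qed.

Lemma sin_natpi k : sin (k%:R * pi) = 0 :> R.
Proof.
elim: k => [|k IH]; first by rewrite mul0r sin0.
by rewrite -natr1 mulrDl mul1r sinDpi IH oppr0.
Qed.

Lemma symtridiag_toeplitz_eigenvalue n d s h : (1 <= h <= n)%N ->
  eigenvalue (symtridiag_toeplitz n d s) (toeplitz_eigenvalue n d s h).
Proof.
move=> hn; have /andP[t0 tpi] := angle_in hn; set t := angle n h in t0 tpi.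
apply/eigenvalueP; exists (\row_(j < n) sin (j.+1%:R * t)).
  apply/rowP => j; rewrite !mxE.
  under eq_bigr do rewrite mxE.
  rewrite (@symtridiag_toeplitz_mulrow n d s (fun k => sin (k%:R * t))).
  - have -> : j%:R * t = j.+1%:R * t - t by rewrite -natr1; ring.
    have -> : j.+2%:R * t = j.+1%:R * t + t by rewrite -(natr1 j.+1); ring.
    by rewrite /toeplitz_eigenvalue -/(angle n h) -/t sinB sinD; ring.
  - by rewrite mul0r sin0.
  - by rewrite /t /angle mulrC divfK ?pnatr_eq0// sin_natpi.
have n0 : (0 < n)%N by case/andP: hn => h1; apply: leq_trans.
apply/eqP => /rowP /(_ (Ordinal n0)); rewrite !mxE /= mul1r.
by apply/eqP; rewrite gt_eqF// sin_gt0_pi// t0.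
Qed.

Lemma char_poly_symtridiag_toeplitz n d s :
  char_poly (symtridiag_toeplitz n d s) =
  \prod_(1 <= h < n.+1) ('X - (toeplitz_eigenvalue n d s h)%:P).
Proof.
have [->|s0] := eqVneq s 0.
  rewrite char_poly_trig; last first.
    apply/is_trig_mxP => i j ij; rewrite mxE if_same ifF//.
    by apply: contraTF ij => /eqP ->; rewrite ltnn.
  rewrite big_add1 /= big_mkord; apply: eq_bigr => i _.
  by rewrite mxE eqxx /toeplitz_eigenvalue mulr0 mul0r addr0.
have cmp : {in index_iota 1 n.+1 &, injective (toeplitz_eigenvalue n d s)}.
  move=> a b; rewrite !mem_index_iota !ltnS => an bn /addrI /mulfI eqab.
  have /andP[a0 api] := angle_in an; have /andP[b0 bpi] := angle_in bn.
  have : angle n a = angle n b.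
    apply: cos_inj; rewrite ?in_itv /= ?ltW//.
    by apply: eqab; rewrite mulf_neq0// pnatr_eq0.
  have n1 : (n.+1%:R : R)^-1 != 0 by rewrite invr_neq0// pnatr_eq0.
  have pi0 : (pi : R) != 0 by rewrite gt_eqF ?pi_gt0.
  by move=> /(mulIf n1) /(mulIf pi0) /eqP; rewrite eqr_nat => /eqP.
rewrite -(big_map (toeplitz_eigenvalue n d s) xpredT (fun x => 'X - x%:P)).
rewrite [LHS](@all_roots_prod_XsubC _ _
  [seq toeplitz_eigenvalue n d s h | h <- index_iota 1 n.+1]).
- by rewrite (monicP (char_poly_monic _)) scale1r.
- by rewrite size_char_poly size_map size_iota subn1.
- apply/allP => _ /mapP[h hn ->]; rewrite -eigenvalue_root_char.
  by apply: symtridiag_toeplitz_eigenvalue; move: hn; rewrite mem_index_iota ltnS.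
- by rewrite uniq_rootsE map_inj_in_uniq ?iota_uniq.
Qed.

End Spectrum.

(* Main.v *)
Require Import Defs.
From mathcomp Require Import all_boot all_order all_algebra.
From mathcomp Require Import reals trigo.
From mathcomp Require Import ring.

Import Order.TTheory GRing.Theory Num.Theory.
Local Open Scope ring_scope.

(** On the plane of matrices [(n; d, s)] the squared Frobenius norm is the
    diagonal quadratic form [n d^2 + 2 (n - 1) s^2]
    ([sum_sqr_symtridiag_toeplitz]), and having null [h]-th eigenvalue is the
    linear condition [d + 2 c s = 0], that is, lying on a line through the
    origin.  For [n >= 2] the form is positive definite, so the closest point
    [(delta_star, sigma_star)] is the orthogonal projection of [T] onto that
    line.  The residual [(delta - delta_star, sigma - sigma_star)] is the multiple
    [(delta + 2 c sigma) / (n - 1 + 2 n c^2)] of [(n - 1, n c)], and this vector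
    represents the functional [d + 2 c s] with respect to the form, up to the
    factor [n (n - 1)].  Hence the residual is orthogonal to the line, and
    Pythagoras ([projection_pythagoras]) gives both minimality and uniqueness;
    the distance is the length of the residual
    ([projection_residual_norm2]). *)

Section ToeplitzFrobenius.
Variable R : realType.
Implicit Types (n : nat) (d s : R).

Lemma symtridiag_toeplitzB n d s d' s' :
  symtridiag_toeplitz n d s - symtridiag_toeplitz n d' s' =
  symtridiag_toeplitz n (d - d') (s - s').
Proof.
by apply/matrixP => i j; rewrite !mxE; do 2 case: ifP => // _; rewrite subrr.
Qed.

(** The entrywise square of [(n; d, s)] is [(n; d^2, s^2)], whose column sums
    come from multiplying it by the row vector of ones, extended by zero at both
    ends. *)
Lemma sum_sqr_symtridiag_toeplitz n d s : (0 < n)%N ->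
  \sum_i \sum_j symtridiag_toeplitz n d s i j ^+ 2 =
  n%:R * d ^+ 2 + 2 * (n%:R - 1) * s ^+ 2.
Proof.
case: n => // n _; rewrite exchange_big /=.
pose one k : R := (0 < k <= n.+1)%N%:R.
transitivity (\sum_(j < n.+1) (d ^+ 2 * one j.+1 + s ^+ 2 * (one j + one j.+2))).
  apply: eq_bigr => j _.
  rewrite -(@symtridiag_toeplitz_mulrow _ _ (d ^+ 2) (s ^+ 2) one); last 2 first.
  - by [].
  - by rewrite /one ltnn.
  apply: eq_bigr => i _; rewrite /one /= ltn_ord mul1r !mxE.
  by do 2 case: ifP => // _; rewrite expr0n.
have sum_one (f : nat -> R) k : (forall i, (i < k)%N -> f i = 1) ->
    \sum_(i < k) f i = k%:R.
  move=> f1; rewrite (eq_bigr (fun=> 1)) => [|i _]; last exact: f1.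
  by rewrite sumr_const card_ord.
rewrite big_split /= -!mulr_sumr big_split /=.
rewrite (sum_one (fun j => one j.+1)) => [|i ilt]; last by rewrite /one /= ilt.
(* The column sums lose one off-diagonal entry at each end of the matrix. *)
rewrite [\sum_(j < _) one j]big_ord_recl (sum_one (fun j => one j.+1)); last first.
  by move=> i ilt; rewrite /one /= ltnW.
rewrite big_ord_recr /= (sum_one (fun j => one j.+2)); last first.
  by move=> i ilt; rewrite /one /= ltnS ilt.
by rewrite /one /= ltnn -(natr1 n) mulr0n; ring.
Qed.

Lemma frobenius_norm_symtridiag_toeplitz n d s : (0 < n)%N ->
  frobenius_norm (symtridiag_toeplitz n d s) =
  Num.sqrt (n%:R * d ^+ 2 + 2 * (n%:R - 1) * s ^+ 2).
Proof. by move=> n0; rewrite /frobenius_norm sum_sqr_symtridiag_toeplitz. Qed.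

End ToeplitzFrobenius.

Section WeightedProjection.
Variable R : realType.
Variables (N c delta sigma : R).
Hypothesis N_gt1 : 1 < N.

(* The real number [N] stands for the matrix size. *)
Let den := N - 1 + 2 * N * c ^+ 2.
Let norm2 (x y : R) := N * x ^+ 2 + 2 * (N - 1) * y ^+ 2.
Let delta_star := 2 * (N * c ^+ 2 * delta - (N - 1) * c * sigma) / den.
Let sigma_star := ((N - 1) * sigma - N * c * delta) / den.

Let N_gt0 : 0 < N. Proof. exact: lt_trans N_gt1. Qed.
Let N1_gt0 : 0 < N - 1. Proof. by rewrite subr_gt0. Qed.
Let den_neq0 : den != 0.
Proof. by rewrite gt_eqF // ltr_wpDr // mulr_ge0 ?sqr_ge0 // mulr_ge0 ?ltW. Qed.

Lemma projection_on_line : delta_star + 2 * sigma_star * c = 0.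
Proof. by rewrite /delta_star /sigma_star; field. Qed.

Lemma projection_residual :
  delta - delta_star = (N - 1) * (delta + 2 * c * sigma) / den /\
  sigma - sigma_star = N * c * (delta + 2 * c * sigma) / den.
Proof.
by rewrite /delta_star /sigma_star; split; move: den_neq0; rewrite /den => ?; field.
Qed.

(** The cross term of the expansion is a multiple of
    [(delta_star - d) + 2 c (sigma_star - s)], which vanishes as both points lie on the
    line. *)
Lemma projection_pythagoras d s : d + 2 * s * c = 0 ->
  norm2 (delta - d) (sigma - s) =
  norm2 (delta - delta_star) (sigma - sigma_star) +
  norm2 (delta_star - d) (sigma_star - s).
Proof.
move=> ds0; have [rd rs] := projection_residual.
have -> : delta - d = (delta - delta_star) + (delta_star - d) by ring.
have -> : sigma - s = (sigma - sigma_star) + (sigma_star - s) by ring.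
have dE : d = - (2 * s * c) by apply/eqP; rewrite -addr_eq0 ds0.
have dsE : delta_star = - (2 * sigma_star * c).
  by apply/eqP; rewrite -addr_eq0 projection_on_line.
by rewrite rd rs dE dsE /norm2; ring.
Qed.

Lemma norm2_ge0 x y : 0 <= norm2 x y.
Proof.
by rewrite addr_ge0 // mulr_ge0 ?sqr_ge0 ?mulr_ge0 ?(ltW N_gt0) ?(ltW N1_gt0).
Qed.

Lemma norm2_le0 x y : norm2 x y <= 0 -> x = 0 /\ y = 0.
Proof.
move=> le0; have : norm2 x y == 0 by rewrite eq_le le0 norm2_ge0.
rewrite paddr_eq0; last 2 first.
- by rewrite mulr_ge0 ?sqr_ge0 ?ltW.
- by rewrite mulr_ge0 ?sqr_ge0 ?mulr_ge0 ?(ltW N1_gt0).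
rewrite !mulf_eq0 !orbb.
by rewrite (gt_eqF N_gt0) (gt_eqF N1_gt0) pnatr_eq0 /= => /andP[/eqP -> /eqP ->].
Qed.

Lemma projection_residual_norm2 :
  norm2 (delta - delta_star) (sigma - sigma_star) =
  (delta + 2 * c * sigma) ^+ 2 / (1 / N + 2 * c ^+ 2 / (N - 1)).
Proof.
have [-> ->] := projection_residual; move: den_neq0; rewrite /norm2 /den => D0.
have N0 : N != 0 by rewrite gt_eqF.
have N1 : N - 1 != 0 by rewrite gt_eqF.
have -> : 1 / N + 2 * c ^+ 2 / (N - 1) = (N - 1 + 2 * N * c ^+ 2) / (N * (N - 1)).
  by field; rewrite N0 N1.
by field; rewrite N0 N1 D0.
Qed.

End WeightedProjection.

Theorem theorem4p1 (R : realType) (n : nat) (delta sigma : R) (h : nat)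
    (hn : (2 <= n)%N) (hh : (1 <= h <= n)%N) :
  let c : R := cos (h%:R * pi / n.+1%:R) in
  let T : 'M[R]_n := symtridiag_toeplitz n delta sigma in
  let delta_star : R :=
    2 * (n%:R * c ^+ 2 * delta - (n%:R - 1) * c * sigma)
      / (n%:R - 1 + 2 * n%:R * c ^+ 2) in
  let sigma_star : R :=
    ((n%:R - 1) * sigma - n%:R * c * delta)
      / (n%:R - 1 + 2 * n%:R * c ^+ 2) in
  let S_star : 'M[R]_n := symtridiag_toeplitz n delta_star sigma_star in
  [/\ frobenius_closest (@symtridiag_toeplitz_null R n h) T S_star,
      forall S : 'M[R]_n,
        frobenius_closest (@symtridiag_toeplitz_null R n h) T S -> S = S_star
    & frobenius_norm (T - S_star)
        = `|delta + 2 * c * sigma|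
            / Num.sqrt (1 / n%:R + 2 * c ^+ 2 / (n%:R - 1))].
Proof.
move=> c T ds ss S_star.
have n0 : (0 < n)%N by apply: ltnW.
have N_gt1 : 1 < n%:R :> R by rewrite ltr1n.
have null_star : symtridiag_toeplitz_null h S_star.
  by exists ds, ss; split=> //; apply: projection_on_line.
have normB (d s d' s' : R) : frobenius_norm
    (symtridiag_toeplitz n d s - symtridiag_toeplitz n d' s') =
    Num.sqrt (n%:R * (d - d') ^+ 2 + 2 * (n%:R - 1) * (s - s') ^+ 2).
  by rewrite symtridiag_toeplitzB frobenius_norm_symtridiag_toeplitz.
split.
- split=> // _ [d [s [-> /(projection_pythagoras _ _ _ delta sigma N_gt1) pyth]]].
  by rewrite !normB ler_wsqrtr // pyth lerDl norm2_ge0.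
- move=> _ [[d [s [-> /(projection_pythagoras _ _ _ delta sigma N_gt1) pyth]]]].
  move=> /(_ _ null_star); rewrite !normB ler_sqrt ?norm2_ge0 // pyth gerDl.
  move=> /(norm2_le0 _ _ N_gt1) [/eqP dE /eqP sE].
  by move: dE sE; rewrite !subr_eq0 /S_star => /eqP <- /eqP <-.
rewrite normB projection_residual_norm2 // sqrtrM ?sqr_ge0 // sqrtr_sqr.
have N1_ge0 : 0 <= n%:R - 1 :> R by rewrite subr_ge0 ltW.
by rewrite sqrtrV // addr_ge0 // divr_ge0 // mulr_ge0 ?sqr_ge0.
Qed.
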